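(* Let $2<\tau<3$, $0<h_{\min}<N$, and let $a,b$ satisfy $0<ah_{\min}\le ah_{\min}b\le 1\le b<\infty$ and $ah_{\min}<b$. Then $$C_{ab}^{\max}(\tau)=\frac{A(\tau)(\tau-2)^2}{\big((ah_{\min})^{2-\tau}-b^{2-\tau}\big)^2}\; I_{ab}^{\max}(\tau),$$ where $$I_{ab}^{\max}(\tau)=\frac{\ln(b^2)}{(\tau-2)(3-\tau)}-\frac{1-b^{2(2-\tau)}}{(\tau-2)^2}+\frac{1-2(ah_{\min}b)^{3-\tau}+(ah_{\min})^{2(3-\tau)}}{(3-\tau)^2}.$$
   Context: Let $\rho(h)=h^{-\tau}\big/\int_{h_{\min}}^{N}t^{-\tau}\,dt$ be the power-law density on $[h_{\min},N]$ and $$A(\tau)=\int_{h_{\min}}^{N}\rho(h)\big(1-(1+h)e^{-h}\big)\,dh.$$ For a function $f:[0,\infty)\to(0,1]$ with $f(0)=1$, define $$C_{ab}(\tau)=A(\tau)\,c_{ab}(0),\qquad c_{ab}(0)=\frac{\int_{ah_{\min}}^{b}\int_{ah_{\min}}^{b}(xy)^{2-\tau}f(xy)\,dx\,dy}{\Big(\int_{ah_{\min}}^{b}x^{1-\tau}\,dx\Big)^2}.$$ $C_{ab}^{\max}(\tau)$ denotes $C_{ab}(\tau)$ for the choice $f(u)=f_{\max}(u)=\min(1,1/u)$, $u\ge0$ (with $f_{\max}(0)=1$). (In the paper's application, $a=1/h_s$ and $b=h_c/h_s$ for a structural cutoff $h_s$ and natural cutoff $h_c$, and $C_{ab}(\tau)$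 approximates the average clustering coefficient.) *)

(* Defs.v *)
From Stdlib Require Import Reals Lra.
From Coquelicot Require Import Coquelicot.
Open Scope R_scope.

(* Every base of a real power below is positive, where [Rpower x y] is x^y. *)

Definition rho (tau hmin N h : R) : R :=
  Rpower h (- tau) / RInt (fun t => Rpower t (- tau)) hmin N.

Definition A (tau hmin N : R) : R :=
  RInt (fun h => rho tau hmin N h * (1 - (1 + h) * exp (- h))) hmin N.

(* A function [0, oo) -> (0, 1] with value 1 at 0, carried by a function on R
   whose values at negative arguments are irrelevant. *)
Record conn_fun : Type := ConnFun {
  conn_val :> R -> R;
  conn_range : forall u, 0 <= u -> 0 < conn_val u <= 1;
  conn_at0 : conn_val 0 = 1
}.

Definition c_ab0 (f : conn_fun) (tau hmin a b : R) : R :=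
  RInt (fun y => RInt (fun x => Rpower (x * y) (2 - tau) * f (x * y))
                      (a * hmin) b)
       (a * hmin) b
  / (RInt (fun x => Rpower x (1 - tau)) (a * hmin) b) ^ 2.

Definition C_ab (f : conn_fun) (tau hmin N a b : R) : R :=
  A tau hmin N * c_ab0 f tau hmin a b.

(* The case u = 0 is separate because [/ 0] evaluates to [0]. *)
Definition f_max_val (u : R) : R :=
  if Req_EM_T u 0 then 1 else Rmin 1 (1 / u).

Lemma f_max_range (u : R) : 0 <= u -> 0 < f_max_val u <= 1.
Proof.
intros Hu; unfold f_max_val; destruct (Req_EM_T u 0) as [_ | Hne]; [lra |].
split; [| apply Rmin_l].
apply Rmin_glb_lt; [lra |].
apply Rdiv_lt_0_compat; lra.
Qed.

Lemma f_max_at0 : f_max_val 0 = 1.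
Proof. unfold f_max_val; destruct (Req_EM_T 0 0); lra. Qed.

Definition f_max : conn_fun := ConnFun f_max_val f_max_range f_max_at0.

Definition C_ab_max (tau hmin N a b : R) : R := C_ab f_max tau hmin N a b.

Definition I_ab_max (tau hmin a b : R) : R :=
  ln (b ^ 2) / ((tau - 2) * (3 - tau))
  - (1 - Rpower b (2 * (2 - tau))) / (tau - 2) ^ 2
  + (1 - 2 * Rpower (a * hmin * b) (3 - tau)
     + Rpower (a * hmin) (2 * (3 - tau))) / (3 - tau) ^ 2.

(* Main.v *)
Require Import Defs.
From Stdlib Require Import Reals Lra.
From Coquelicot Require Import Coquelicot.
Open Scope R_scope.

(** Put [c = a * hmin] and [p = 2 - tau].  The function [f_max] is [1] up to
    [u = 1] and [1 / u] beyond, so the integrand [(x y)^p f_max (x y)] of the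
    numerator is [(x y)^p] below the hyperbola [x y = 1] and [(x y)^(p - 1)]
    above it; on either side it separates into a power of [x] times a power
    of [y].

    The hypothesis [c b <= 1] says that the hyperbola leaves the square
    [[c, b]^2] through the sides [x = b] and [y = b], at height (respectively
    abscissa) [/ b].  So a horizontal line at height [y <= / b] stays below the
    hyperbola ([inner_integral_low]), whereas one at height [/ b <= y <= b]
    crosses it once, at [x = / y] ([inner_integral_high]).  As a function of
    [y], the inner integral is therefore a multiple of [y^p] on [[c, / b]], and
    a combination of [/ y], [y^p] and [y^(p - 1)] on [[/ b, b]].  The term
    [/ y] is where the logarithm [ln b - ln (/ b) = ln (b^2)] comes from;
    the powers contribute the remaining terms, and those in [(c / b)^(p + 1)]
    cancel between the two parts of the interval
    ([double_integral_f_max]).  The denominator of [c_ab0] is the square of the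
    integral of the single power [x^(p - 1)], which gives the prefactor. *)

(** * Integrals of powers *)

Lemma RInt_eq (f : R -> R) (u v k l : R) :
  is_RInt f u v k -> k = l -> RInt f u v = l.
Proof. intros Hk <-; now apply is_RInt_unique. Qed.

Lemma is_RInt_Rpower (r u v : R) :
  r + 1 <> 0 -> 0 < u -> u <= v ->
  is_RInt (fun x => Rpower x r) u v
          ((Rpower v (r + 1) - Rpower u (r + 1)) / (r + 1)).
Proof.
intros Hr Hu Huv.
replace ((Rpower v (r + 1) - Rpower u (r + 1)) / (r + 1))
  with (minus (Rpower v (r + 1) / (r + 1)) (Rpower u (r + 1) / (r + 1)))
  by (unfold minus, plus, opp; simpl; field; exact Hr).
apply (is_RInt_derive (fun x => Rpower x (r + 1) / (r + 1))).
- intros x; rewrite Rmin_left, Rmax_right by lra; intros Hx.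
  unfold Rpower; auto_derive; [lra |].
  replace ((r + 1) * ln x) with (r * ln x + ln x) by ring.
  rewrite exp_plus, exp_ln by lra.
  field; lra.
- intros x; rewrite Rmin_left, Rmax_right by lra; intros Hx.
  apply (ex_derive_continuous (fun x => Rpower x r)).
  unfold Rpower; auto_derive; lra.
Qed.

Lemma is_RInt_Rpower_pred (r u v : R) :
  r <> 0 -> 0 < u -> u <= v ->
  is_RInt (fun x => Rpower x (r - 1)) u v ((Rpower v r - Rpower u r) / r).
Proof.
intros Hr Hu Huv.
assert (H := is_RInt_Rpower (r - 1) u v).
replace (r - 1 + 1) with r in H by ring.
now apply H.
Qed.

Lemma is_RInt_Rinv (u v : R) :
  0 < u -> u <= v -> is_RInt (fun x => / x) u v (ln v - ln u).
Proof.
intros Hu Huv.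
apply (is_RInt_derive ln).
- intros x; rewrite Rmin_left, Rmax_right by lra; intros Hx.
  auto_derive; [lra | field; lra].
- intros x; rewrite Rmin_left, Rmax_right by lra; intros Hx.
  apply (ex_derive_continuous (fun x => / x)).
  auto_derive; lra.
Qed.

(** * The integrand on either side of the hyperbola *)

Lemma integrand_below (p x y : R) :
  0 < x -> 0 < y -> x * y <= 1 ->
  Rpower (x * y) p * f_max_val (x * y) = Rpower y p * Rpower x p.
Proof.
intros Hx Hy Hxy.
assert (H0 : 0 < x * y) by now apply Rmult_lt_0_compat.
unfold f_max_val; destruct (Req_EM_T (x * y) 0); [lra |].
rewrite Rmin_left.
- rewrite <- Rpower_mult_distr by assumption; ring.
- apply Rmult_le_reg_r with (x * y); [assumption |].
  replace (1 / (x * y) * (x * y)) with 1 by (field; lra).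
  lra.
Qed.

Lemma integrand_above (p x y : R) :
  0 < x -> 0 < y -> 1 <= x * y ->
  Rpower (x * y) p * f_max_val (x * y)
  = Rpower y (p - 1) * Rpower x (p - 1).
Proof.
intros Hx Hy Hxy.
unfold f_max_val; destruct (Req_EM_T (x * y) 0); [lra |].
rewrite Rmin_right.
- rewrite (Rmult_comm (Rpower y _)), Rpower_mult_distr by assumption.
  unfold Rminus; rewrite Rpower_plus, Rpower_Ropp, Rpower_1 by lra.
  field; lra.
- apply Rmult_le_reg_r with (x * y); [lra |].
  replace (1 / (x * y) * (x * y)) with 1 by (field; lra).
  lra.
Qed.

Lemma is_RInt_below (p c v y : R) :
  p + 1 <> 0 -> 0 < c -> c <= v -> 0 < y -> v * y <= 1 ->
  is_RInt (fun x => Rpower (x * y) p * f_max_val (x * y)) c v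
    (Rpower y p * ((Rpower v (p + 1) - Rpower c (p + 1)) / (p + 1))).
Proof.
intros Hp Hc Hcv Hy Hvy.
apply (is_RInt_ext (fun x => Rpower y p * Rpower x p)).
- intros x; rewrite Rmin_left, Rmax_right by lra; intros Hx.
  symmetry; apply integrand_below; try lra.
  apply Rle_trans with (v * y); [| assumption].
  apply Rmult_le_compat_r; lra.
- apply (is_RInt_scal (fun x => Rpower x p)), is_RInt_Rpower; assumption.
Qed.

Lemma is_RInt_above (p u b y : R) :
  p <> 0 -> 0 < u -> u <= b -> 0 < y -> 1 <= u * y ->
  is_RInt (fun x => Rpower (x * y) p * f_max_val (x * y)) u b
    (Rpower y (p - 1) * ((Rpower b p - Rpower u p) / p)).
Proof.
intros Hp Hu Hub Hy Huy.
apply (is_RInt_ext (fun x => Rpower y (p - 1) * Rpower x (p - 1))).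
- intros x; rewrite Rmin_left, Rmax_right by lra; intros Hx.
  symmetry; apply integrand_above; try lra.
  apply Rle_trans with (u * y); [assumption |].
  apply Rmult_le_compat_r; lra.
- apply (is_RInt_scal (fun x => Rpower x (p - 1))), is_RInt_Rpower_pred; assumption.
Qed.

(** * The inner integral *)

Lemma inner_integral_low (p c b y : R) :
  p + 1 <> 0 -> 0 < c -> c <= b -> 0 < y -> b * y <= 1 ->
  RInt (fun x => Rpower (x * y) p * f_max_val (x * y)) c b
  = (Rpower b (p + 1) - Rpower c (p + 1)) / (p + 1) * Rpower y p.
Proof.
intros; rewrite Rmult_comm.
now apply is_RInt_unique, is_RInt_below.
Qed.

Lemma Rpower_Rinv_l (y r : R) : 0 < y -> Rpower (/ y) r = / Rpower y r.
Proof.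
intros Hy; rewrite <- Rpower_Ropp; unfold Rpower.
rewrite ln_Rinv by assumption.
f_equal; ring.
Qed.

(** Both pieces evaluate their primitive at the crossing point [x = / y],
    where the power of [x] combines with the factor in [y] to [/ y]:
    [y^p (/ y)^(p + 1) = y^(p - 1) (/ y)^p = / y]. *)
Lemma inner_integral_high (p c b y : R) :
  p <> 0 -> p + 1 <> 0 -> 0 < c -> 0 < y -> c * y <= 1 -> 1 <= b * y ->
  RInt (fun x => Rpower (x * y) p * f_max_val (x * y)) c b
  = (/ (p + 1) - / p) * / y
    + (- (Rpower c (p + 1) / (p + 1)) * Rpower y p
       + Rpower b p / p * Rpower y (p - 1)).
Proof.
intros Hp Hp1 Hc Hy Hcy Hby.
assert (Hyi : 0 < / y) by now apply Rinv_0_lt_compat.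
assert (Hyy : / y * y = 1) by (field; lra).
assert (Hci : c <= / y) by (apply Rmult_le_reg_r with y; lra).
assert (Hbi : / y <= b) by (apply Rmult_le_reg_r with y; lra).
apply (RInt_eq _ _ _ _ _ (is_RInt_Chasles _ _ _ _ _ _
  (is_RInt_below p c (/ y) y Hp1 Hc Hci Hy ltac:(lra))
  (is_RInt_above p (/ y) b y Hp Hyi Hbi Hy ltac:(lra)))).
assert (Hyp : 0 < Rpower y p) by apply exp_pos.
unfold plus; simpl.
rewrite !Rpower_Rinv_l by assumption.
unfold Rminus; rewrite !Rpower_plus, Rpower_Ropp, !Rpower_1 by assumption.
field; repeat split; lra.
Qed.

(** * The double integral *)

Lemma double_integral_f_max (p c b : R) :
  p <> 0 -> p + 1 <> 0 -> 0 < c -> 1 <= b -> c * b <= 1 ->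
  RInt (fun y => RInt (fun x => Rpower (x * y) p * f_max_val (x * y)) c b) c b
  = ln (b ^ 2) * (/ (p + 1) - / p)
    - (1 - Rpower b (2 * p)) / p ^ 2
    + (1 - 2 * Rpower (c * b) (p + 1) + Rpower c (2 * (p + 1)))
      / (p + 1) ^ 2.
Proof.
intros Hp Hp1 Hc Hb Hcb.
assert (Hbi : 0 < / b) by (apply Rinv_0_lt_compat; lra).
assert (Hbb : / b * b = 1) by (field; lra).
assert (Hci : c <= / b) by (apply Rmult_le_reg_r with b; lra).
assert (Hib : / b <= b).
{ apply Rle_trans with 1; [| assumption].
  rewrite <- Rinv_1; apply Rinv_le_contravar; lra. }
assert (Hlow : is_RInt
  (fun y => RInt (fun x => Rpower (x * y) p * f_max_val (x * y)) c b) c (/ b)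
  ((Rpower b (p + 1) - Rpower c (p + 1)) / (p + 1)
   * ((Rpower (/ b) (p + 1) - Rpower c (p + 1)) / (p + 1)))).
{ apply (is_RInt_ext
    (fun y => (Rpower b (p + 1) - Rpower c (p + 1)) / (p + 1) * Rpower y p)).
  - intros y; rewrite Rmin_left, Rmax_right by lra; intros Hy.
    symmetry; apply inner_integral_low; try lra.
    rewrite <- Hbb, (Rmult_comm b); apply Rmult_le_compat_r; lra.
  - apply (is_RInt_scal (fun y => Rpower y p)).
    now apply is_RInt_Rpower. }
assert (Hhigh : is_RInt
  (fun y => RInt (fun x => Rpower (x * y) p * f_max_val (x * y)) c b) (/ b) b
  ((/ (p + 1) - / p) * (ln b - ln (/ b))
   + (- (Rpower c (p + 1) / (p + 1))
        * ((Rpower b (p + 1) - Rpower (/ b) (p + 1)) / (p + 1))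
      + Rpower b p / p * ((Rpower b p - Rpower (/ b) p) / p)))).
{ apply (is_RInt_ext (fun y =>
    (/ (p + 1) - / p) * / y
    + (- (Rpower c (p + 1) / (p + 1)) * Rpower y p
       + Rpower b p / p * Rpower y (p - 1)))).
  - intros y; rewrite Rmin_left, Rmax_right by lra; intros Hy.
    symmetry; apply inner_integral_high; try lra.
    + apply Rle_trans with (c * b); [| assumption].
      apply Rmult_le_compat_l; lra.
    + rewrite <- Hbb, (Rmult_comm b); apply Rmult_le_compat_r; lra.
  - apply (is_RInt_plus (V := R_NormedModule));
      [| apply (is_RInt_plus (V := R_NormedModule))].
    + apply (is_RInt_scal (fun y => / y)), is_RInt_Rinv; assumption.
    + apply (is_RInt_scal (fun y => Rpower y p)), is_RInt_Rpower; assumption.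
    + apply (is_RInt_scal (fun y => Rpower y (p - 1))), is_RInt_Rpower_pred;
        assumption. }
apply (RInt_eq _ _ _ _ _ (is_RInt_Chasles _ _ _ _ _ _ Hlow Hhigh)).
assert (Hbq : 0 < Rpower b (p + 1)) by apply exp_pos.
assert (Hbp : 0 < Rpower b p) by apply exp_pos.
unfold plus; simpl AbelianMonoid.plus.
rewrite !Rpower_Rinv_l, ln_Rinv, ln_pow by lra.
rewrite <- (Rpower_mult_distr c b) by lra.
replace (2 * (p + 1)) with ((p + 1) + (p + 1)) by ring.
replace (2 * p) with (p + p) by ring.
rewrite (Rpower_plus (p + 1) (p + 1) c), (Rpower_plus p p b).
simpl INR.
field; repeat split; lra.
Qed.

(** * The clustering coefficient *)

Theorem proposition3 (tau hmin N a b : R)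
  (Htau : 2 < tau < 3)
  (Hh : 0 < hmin < N)
  (Ha0 : 0 < a * hmin)
  (Hab1 : a * hmin <= a * hmin * b)
  (Hab2 : a * hmin * b <= 1)
  (Hb : 1 <= b)
  (Hab : a * hmin < b) :
  C_ab_max tau hmin N a b =
  A tau hmin N * (tau - 2) ^ 2
    / (Rpower (a * hmin) (2 - tau) - Rpower b (2 - tau)) ^ 2
  * I_ab_max tau hmin a b.
Proof.
assert (Hden : RInt (fun x => Rpower x (1 - tau)) (a * hmin) b
  = (Rpower (a * hmin) (2 - tau) - Rpower b (2 - tau)) / (tau - 2)).
{ apply (RInt_eq _ _ _ _ _
    (is_RInt_Rpower (1 - tau) (a * hmin) b ltac:(lra) Ha0 ltac:(lra))).
  replace (1 - tau + 1) with (2 - tau) by ring.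
  field; lra. }
assert (Hpos : Rpower b (2 - tau) < Rpower (a * hmin) (2 - tau)).
{ unfold Rpower; apply exp_increasing.
  apply Rmult_lt_gt_compat_neg_l; [lra |].
  now apply ln_increasing. }
assert (Hnum := double_integral_f_max (2 - tau) (a * hmin) b
  ltac:(lra) ltac:(lra) Ha0 Hb Hab2).
unfold C_ab_max, C_ab, c_ab0, f_max; cbn [conn_val].
rewrite Hden, Hnum; unfold I_ab_max.
replace (2 - tau + 1) with (3 - tau) by ring.
field; repeat split; lra.
Qed.
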